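(* $\mathsf{CS4}$ has infinitely many $\{\neg,\Diamond\}$-modalities.
   Context: Fix a (nonempty) set $\mathrm{Prop}$ of propositional symbols. Modal formulas are given by the grammar $\varphi := \bot \mid p \mid \varphi\land\varphi \mid \varphi\lor\varphi \mid \varphi\to\varphi \mid \Box\varphi \mid \Diamond\varphi$ with $p\in\mathrm{Prop}$; $\Box$ and $\Diamond$ are not interdefinable. Put $\neg\varphi := \varphi\to\bot$. A relation is a preorder if it is reflexive and transitive. For a relation $R$ on $W$, a set $A\subseteq W$ is an $R$-upset iff $w\in A$ and $wRv$ imply $v\in A$. A birelational $\mathsf{CS4}$-model is a tuple $M=\langle W, W^\bot, \preceq, \sqsubseteq, V\rangle$ where $W$ is a set of worlds, $W^\bot\subseteq W$ is the set of fallible worlds, $\preceq$ and $\sqsubseteq$ are preorders on $W$, and $V:\mathrm{Prop}\to\mathcal{P}(W)$, such that: (i) $M$ is backward confluent: $w\sqsubseteq v\preceq v'$ implies there is $w'$ with $w\preceq w'$ and $w'\sqsubseteq v'$; (ii) for every $p\in\mathrm{Prop}$, $V(p)$ is a $\preceq$-upset and $W^\bot\subseteq V(p)$; (iii) $W^\bot$ is both a $\preceq$-upset and a $\sqsubseteq$-upset. Truth: $M,w\models p$ iff $w\in V(p)$; $M,w\models\bot$ iff $w\in W^\bot$; $\land,\lor$ are evaluated pointwise; $M,w\models\varphi\to\psi$ iff for all $v$ with $w\preceq v$, $M,v\models\varphi$ implies $M,v\models\psi$; $M,w\models\Box\varphi$ iff for all $v,u$ with $w\preceq v$ and $v\sqsubseteq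 u$, $M,u\models\varphi$; $M,w\models\Diamond\varphi$ iff for all $v$ with $w\preceq v$ there is $u$ with $v\sqsubseteq u$ and $M,u\models\varphi$. Write $\|\varphi\|^M := \{w\in W\mid M,w\models\varphi\}$. For $X\subseteq\{\neg,\Box,\Diamond\}$, an $X$-modality is a finite (possibly empty) sequence $\sigma\in X^{<\omega}$; $\sigma\varphi$ denotes the formula obtained by prefixing $\sigma$ to $\varphi$. Modalities $\sigma,\tau$ are $\mathsf{CS4}$-equivalent if $\|\sigma\varphi\|^M=\|\tau\varphi\|^M$ for every $\mathsf{CS4}$-model $M$ and every formula $\varphi$. $\mathsf{CS4}$ has finitely many $X$-modalities iff there is a finite set $\Sigma\subseteq X^{<\omega}$ such that every $X$-modality is $\mathsf{CS4}$-equivalent to some $\sigma\in\Sigma$; otherwise it has infinitely many $X$-modalities. *)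

(* Defs.v *)
(* Stdlib world. *)
From Stdlib Require Import List Relations.

Set Implicit Arguments.

(* [Atom] is the set of propositional symbols.  Box and Diamond are independent
   primitives. *)
Inductive formula (Atom : Type) : Type :=
| Bot : formula Atom
| Var : Atom -> formula Atom
| And : formula Atom -> formula Atom -> formula Atom
| Or  : formula Atom -> formula Atom -> formula Atom
| Imp : formula Atom -> formula Atom -> formula Atom
| Box : formula Atom -> formula Atom
| Dia : formula Atom -> formula Atom.

Arguments Bot {Atom}.

Definition Neg (Atom : Type) (phi : formula Atom) : formula Atom := Imp phi Bot.

Definition upset (W : Type) (R : relation W) (A : W -> Prop) : Prop :=
  forall w v, A w -> R w v -> A v.

Definition backward_confluent (W : Type) (le acc : relation W) : Prop :=
  forall w v v', acc w v -> le v v' -> exists w', le w w' /\ acc w' v'.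

(* Subsets of the set of worlds are predicates; [le] is the intuitionistic
   preorder and [acc] the modal one. *)
Record CS4_model (Atom : Type) : Type := {
  world : Type;
  fallible : world -> Prop;
  le : relation world;
  acc : relation world;
  val : Atom -> world -> Prop;
  le_preorder : preorder world le;
  acc_preorder : preorder world acc;
  model_backward_confluent : backward_confluent le acc;
  val_upset : forall p, upset le (val p);
  fallible_val : forall p w, fallible w -> val p w;
  fallible_le_upset : upset le fallible;
  fallible_acc_upset : upset acc fallible
}.

Fixpoint sat (Atom : Type) (M : CS4_model Atom) (w : world M)
    (phi : formula Atom) : Prop :=
  match phi with
  | Bot => fallible M w
  | Var p => val M p w
  | And a b => sat M w a /\ sat M w b
  | Or a b => sat M w a \/ sat M w b
  | Imp a b => forall v, le M w v -> sat M v a -> sat M v b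
  | Box a => forall v u, le M w v -> acc M v u -> sat M u a
  | Dia a => forall v, le M w v -> exists u, acc M v u /\ sat M u a
  end.

Definition truth_set (Atom : Type) (M : CS4_model Atom) (phi : formula Atom) :
    world M -> Prop :=
  fun w => sat M w phi.

Inductive symbol : Set := SNeg | SBox | SDia.

Definition apply_symbol (Atom : Type) (s : symbol) (phi : formula Atom) :
    formula Atom :=
  match s with
  | SNeg => Neg phi
  | SBox => Box phi
  | SDia => Dia phi
  end.

(* The head of the list is the outermost symbol. *)
Definition prefix (Atom : Type) (sigma : list symbol) (phi : formula Atom) :
    formula Atom :=
  fold_right (@apply_symbol Atom) phi sigma.

Definition modality (X : symbol -> Prop) (sigma : list symbol) : Prop :=
  Forall X sigma.

(* Equality of truth sets is extensional. *)
Definition CS4_equivalent (Atom : Type) (sigma tau : list symbol) : Prop :=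
  forall (M : CS4_model Atom) (phi : formula Atom) (w : world M),
    truth_set M (prefix sigma phi) w <-> truth_set M (prefix tau phi) w.

Definition finitely_many_modalities (Atom : Type) (X : symbol -> Prop) : Prop :=
  exists Sigma : list (list symbol),
    Forall (modality X) Sigma /\
    forall sigma, modality X sigma ->
      exists tau, In tau Sigma /\ CS4_equivalent Atom sigma tau.

Definition infinitely_many_modalities (Atom : Type) (X : symbol -> Prop) : Prop :=
  ~ finitely_many_modalities Atom X.

Definition neg_dia : symbol -> Prop := fun s => s = SNeg \/ s = SDia.

(* Main.v *)
Require Import Defs.
From Stdlib Require Import List Relations Lia Arith.
Import ListNotations.

(** Write [C] for double negation.  Both [C] and [Dia] are closure operators, so
    iterating [C Dia] on an atom gives an increasing sequence of formulas.  It
    never stabilises, and a single model without fallible worlds, the ladder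
    below, shows this.

    A double negation holds at a world iff the formula is dense above it.  Level
    [m] of the ladder is a world [Low] lying below a two-element cluster
    [{Far, Near}], so [C] adds [Low] as soon as the cluster is reached.  The
    cluster is maximal, hence [C] alone never enters a new one, and a diamond
    holds on it only if each of its two worlds has a witness.  The only
    witness outside level [m] available to [Near] is [Low] of level [m - 1]:
    thus [C Dia] climbs exactly one level.  Backward confluence asks
    that the cluster of level [m] also see the cluster of level [m - 1]; this is
    the task of [Far], which sees all lower levels but cannot make a diamond
    true without the consent of its twin [Near].

    Hence the [n]-th iterate applied to an atom true at level 0 holds exactly at
    the levels up to [n] ([sat_climb]).  A modality can then be equivalent to at
    most one iterate, and finitely many modalities cannot represent them all. *)

(** * The ladder model *)

Inductive kind : Set := Far | Near | Low.

Definition ladder_le : relation (nat * kind) := fun w v =>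
  fst w = fst v /\ (snd v = Low -> snd w = Low).

Definition ladder_acc : relation (nat * kind) := fun w v =>
  w = v \/
  (snd w = Far /\ fst v < fst w) \/
  (snd w = Near /\ snd v = Low /\ fst w = S (fst v)).

Lemma ladder_le_preorder : preorder _ ladder_le.
Proof.
  split.
  - intros w; split; auto.
  - intros w v u [E1 H1] [E2 H2]; split; [congruence | auto].
Qed.

Lemma ladder_acc_preorder : preorder _ ladder_acc.
Proof.
  split.
  - intros w; left; reflexivity.
  - intros w v u Hwv Hvu.
    destruct Hwv as [-> | Hwv]; [exact Hvu |].
    destruct Hvu as [<- | Hvu]; [right; exact Hwv |].
    destruct Hwv as [[Hw Hlt] | (Hw & Hv & Hlt)].
    + right; left; split; [exact Hw |].
      destruct Hvu as [[_ H] | (_ & _ & H)]; lia.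
    + rewrite Hv in Hvu; destruct Hvu as [[H _] | [H _]]; discriminate.
Qed.

(** The only interesting instance is a step from [Near] down to [Low] followed by
    a step into the lower cluster: it is completed by moving from [Near] to its
    twin [Far]. *)
Lemma ladder_backward_confluent : backward_confluent ladder_le ladder_acc.
Proof.
  intros w v v' Hwv [E Hle].
  destruct Hwv as [-> | [[Hw Hlt] | (Hw & Hv & Hlt)]].
  - exists v'; split; [split; auto | left; reflexivity].
  - exists w; split; [split; auto |].
    right; left; split; [exact Hw | lia].
  - exists (fst w, Far); split.
    + split; [reflexivity | discriminate].
    + right; left; simpl; split; [reflexivity | lia].
Qed.

Definition ladder (Atom : Type) : CS4_model Atom.
Proof.
  refine {| world := nat * kind;
            fallible := fun _ => False;
            le := ladder_le;
            acc := ladder_acc;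
            val := fun _ w => fst w = 0;
            le_preorder := ladder_le_preorder;
            acc_preorder := ladder_acc_preorder;
            model_backward_confluent := ladder_backward_confluent |}.
  - intros _ w v Hw [E _]; congruence.
  - intros _ w [].
  - intros w v [].
  - intros w v [].
Defined.

(** * Climbing the ladder *)

(** The bound [S n] is attained because both worlds of the cluster of level
    [S n] see [Low] of level [n], and it is sharp because [Near] sees nothing
    else outside its own level. *)
Lemma sat_neg_neg_dia (Atom : Type) (phi : formula Atom) (n : nat) :
  (forall w : world (ladder Atom), sat (ladder Atom) w phi <-> fst w <= n) ->
  forall w : world (ladder Atom),
    sat (ladder Atom) w (Neg (Neg (Dia phi))) <-> fst w <= S n.
Proof.
  intros Hphi [m k]; simpl; split.
  - intros H.
    destruct (le_dec m (S n)) as [Hm | Hm]; [exact Hm | exfalso].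
    apply (H (m, Near)); [split; [reflexivity | discriminate] |].
    intros [m' k'] [E _] Hdia; simpl in E; subst m'.
    (* [Near] lies above every world of its level, so the diamond needs a
       witness at [Near]. *)
    destruct (Hdia (m, Near)) as ([j l] & Hacc & Hsat);
      [split; [reflexivity | discriminate] |].
    apply Hphi in Hsat; simpl in Hsat.
    destruct Hacc as [E | [[E _] | (_ & _ & E)]]; simpl in E.
    + injection E; lia.
    + discriminate.
    + lia.
  - intros Hm [m' k'] [E _] Hneg; simpl in E; subst m'.
    apply (Hneg (m, Far)); [split; [reflexivity | discriminate] |].
    intros [m' k''] [E Hk]; simpl in E, Hk; subst m'.
    destruct m as [| m].
    + exists (0, k''); split; [left; reflexivity |].
      apply Hphi; simpl; lia.
    + exists (m, Low); split; [| apply Hphi; simpl; lia].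
      destruct k''; right; simpl.
      * left; split; [reflexivity | lia].
      * right; auto.
      * discriminate (Hk eq_refl).
Qed.

Fixpoint climb (n : nat) : list symbol :=
  match n with
  | 0 => []
  | S n => SNeg :: SNeg :: SDia :: climb n
  end.

Lemma climb_neg_dia (n : nat) : modality neg_dia (climb n).
Proof.
  unfold modality, neg_dia.
  induction n as [| n IH]; simpl; auto 10.
Qed.

Lemma sat_climb (Atom : Type) (p : Atom) (n : nat) (w : world (ladder Atom)) :
  sat (ladder Atom) w (prefix (climb n) (Var p)) <-> fst w <= n.
Proof.
  revert w; induction n as [| n IH].
  - intros [m k]; simpl; lia.
  - exact (sat_neg_neg_dia Atom (prefix (climb n) (Var p)) n IH).
Qed.

Lemma climb_equivalent_inj (Atom : Type) (p : Atom) (i j : nat)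
    (tau : list symbol) :
  CS4_equivalent Atom (climb i) tau -> CS4_equivalent Atom (climb j) tau ->
  i = j.
Proof.
  intros Hi Hj.
  assert (H : forall m, m <= i <-> m <= j).
  { intros m.
    specialize (Hi (ladder Atom) (Var p) (m, Low)).
    specialize (Hj (ladder Atom) (Var p) (m, Low)).
    unfold truth_set in Hi, Hj.
    rewrite sat_climb in Hi, Hj; simpl fst in Hi, Hj.
    tauto. }
  apply Nat.le_antisymm; apply H; lia.
Qed.

(** * A pigeonhole principle *)

(** If [a] were related to some [n], it would be related to nothing beyond [n],
    so that [l] alone would serve all larger indices.  Starting at an arbitrary
    index [N] makes the induction go through without deciding whether such an
    [n] exists. *)
Lemma no_finite_cover (A : Type) (R : nat -> A -> Prop)
    (R_inj : forall i j a, R i a -> R j a -> i = j) (l : list A) :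
  forall N, ~ (forall n, N <= n -> exists a, In a l /\ R n a).
Proof.
  induction l as [| a l IH]; intros N Hcover.
  - destruct (Hcover N (le_n N)) as (a & [] & _).
  - assert (Ha : forall n, N <= n -> ~ R n a).
    { intros n Hn Hna.
      apply (IH (S n)); intros k Hk.
      destruct (Hcover k) as (b & [<- | Hb] & Hkb); [lia | | eauto].
      specialize (R_inj _ _ _ Hna Hkb); lia. }
    apply (IH N); intros n Hn.
    destruct (Hcover n Hn) as (b & [<- | Hb] & Hnb); [| eauto].
    destruct (Ha n Hn Hnb).
Qed.

Theorem theorem9 (Atom : Type) (Atom_nonempty : inhabited Atom) :
  infinitely_many_modalities Atom neg_dia.
Proof.
  destruct Atom_nonempty as [p].
  intros (Sigma & _ & Hcover).
  apply (no_finite_cover _ (fun n tau => CS4_equivalent Atom (climb n) tau)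
           (climb_equivalent_inj Atom p) Sigma 0).
  intros n _; exact (Hcover _ (climb_neg_dia n)).
Qed.
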